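(* Let $G=(V,E)$ be a graph and let $w\in\mathbb{R}^V$ be a nonzero vector with nonnegative entries. Consider the semidefinite program $$t(G,w)=\min\ t \quad\text{subject to}\quad \mathrm{diag}(X)=\tfrac12\bar e+(t-\tfrac12)w,\quad \mathcal{L}_G^*(X)=\bar e+(t-\tfrac12)\mathcal{L}_G^*(W),\quad X\in\mathbb{S}_+^V,\ t\in\mathbb{R},\qquad (\ast)$$ where $W=\sqrt{w}\,\sqrt{w}^{\,T}$. Then, for every feasible solution $(X,t)$ of $(\ast)$ and every nonzero $x\in\mathrm{TH}(\overline{G})$, we have $$2t+\frac{1}{w^{T}x}\ge 1,$$ with equality if and only if $(X,t)$ is optimal for $(\ast)$ and $w^{T}x=\vartheta(\overline{G},w)$. (Here $1/0$ is interpreted as $+\infty$.)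
   Context: Graphs are finite and simple with nonempty vertex set; $\overline{G}$ is the complement of $G$. $\bar e$ is the all-ones vector (of the appropriate dimension); $\mathbb{S}_+^V$ is the set of symmetric positive semidefinite $V\times V$ real matrices; $\mathrm{diag}(X)$ is the diagonal of $X$; $\sqrt{w}$ is the entrywise square root, $(\sqrt w)_i=\sqrt{w_i}$. $\mathcal{L}_G^*$ maps a symmetric $V\times V$ matrix $X$ to the vector in $\mathbb{R}^E$ whose $\{i,j\}$ entry is $X_{ii}-2X_{ij}+X_{jj}$. For a graph $H=(V,F)$, $\vartheta(H,w)=\max\{\sqrt{w}^{\,T}X\sqrt{w} : \mathrm{Tr}(X)=1,\ X_{ij}=0\ \forall\{i,j\}\in F,\ X\in\mathbb{S}_+^V\}$. An orthonormal representation of a graph $H=(V,F)$ is a function $p$ from $V$ to the unit sphere in $\mathbb{R}^d$, for some $d\ge1$, mapping distinct non-adjacent nodes of $H$ to orthogonal vectors. $\mathrm{TH}(H)$ is the set of all $x\in\mathbb{R}^V$ with nonnegative entries such that $\sum_{i\in V}(c^{T}p(i))^2x_i\le 1$ for every orthonormal representation $p:V\to\mathbb{R}^d$ of $H$ and every unit vector $c\in\mathbb{R}^d$. *)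

(* Defs.v *)
From HB Require Import structures.
From mathcomp Require Import all_boot all_order all_algebra.
From mathcomp Require Import all_classical all_reals.

Set Implicit Arguments.
Unset Strict Implicit.
Unset Printing Implicit Defensive.

Import Order.TTheory GRing.Theory Num.Theory.

Local Open Scope classical_set_scope.
Local Open Scope ring_scope.

(* Nonemptiness of the vertex set is not part of the record. *)
Record sgraph (V : finType) := SGraph {
  adj :> rel V;
  adj_sym : symmetric adj;
  adj_irr : irreflexive adj }.

Definition compl_adj (V : finType) (G : sgraph V) : rel V :=
  [rel i j | (i != j) && ~~ G i j].

Lemma compl_adj_sym (V : finType) (G : sgraph V) : symmetric (compl_adj G).
Proof. by move=> i j; rewrite /compl_adj /= eq_sym adj_sym. Qed.

Lemma compl_adj_irr (V : finType) (G : sgraph V) : irreflexive (compl_adj G).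
Proof. by move=> i; rewrite /compl_adj /= eqxx. Qed.

Definition compl (V : finType) (G : sgraph V) : sgraph V :=
  SGraph (compl_adj_sym G) (compl_adj_irr G).

(* Vectors in R^V and V x V matrices are indexed by 'I_#|V|; the coordinate i
   stands for the vertex [enum_val i]. *)
Definition vadj (V : finType) (G : sgraph V) (i j : 'I_#|V|) : bool :=
  G (enum_val i) (enum_val j).

Section Definitions.
Variable R : realType.

(* The Euclidean inner product. Unit vectors are stated through it, because
   the library norm on matrices is the max norm. *)
Definition dotv n (u v : 'cV[R]_n) : R := (u^T *m v) 0 0.

Definition qform n (A : 'M[R]_n) (u : 'cV[R]_n) : R := (u^T *m A *m u) 0 0.

Definition psdmx n (A : 'M[R]_n) : Prop :=
  A^T = A /\ forall u : 'cV[R]_n, 0 <= qform A u.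

Definition diagv n (A : 'M[R]_n) : 'cV[R]_n := \col_i A i i.

Definition sqrtv n (w : 'cV[R]_n) : 'cV[R]_n := map_mx Num.sqrt w.

(* The {i, j} entry of L_G^*(A); only its values at edges of G are used. *)
Definition Lstar n (A : 'M[R]_n) (i j : 'I_n) : R :=
  A i i - 2 * A i j + A j j.

Section Graph.
Variables (V : finType) (H : sgraph V).

Definition theta_feasible : set 'M[R]_#|V| :=
  [set X | [/\ \tr X = 1,
               forall i j, vadj H i j -> X i j = 0
             & psdmx X]].

(* For nonempty V the feasible set is nonempty and compact, so the maximum
   is attained and is this supremum. *)
Definition theta (w : 'cV[R]_#|V|) : R :=
  sup [set qform X (sqrtv w) | X in theta_feasible].

Definition orthonormal_rep d (p : V -> 'cV[R]_d) : Prop :=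
  (forall a, dotv (p a) (p a) = 1) /\
  (forall a b, a != b -> ~~ H a b -> dotv (p a) (p b) = 0).

Definition TH : set 'cV[R]_#|V| :=
  [set x | (forall i, 0 <= x i 0) /\
     forall (d : nat) (p : V -> 'cV[R]_d) (c : 'cV[R]_d),
       (0 < d)%N -> orthonormal_rep p -> dotv c c = 1 ->
       \sum_i dotv c (p (enum_val i)) ^+ 2 * x i 0 <= 1].

Definition sdp_feasible (w : 'cV[R]_#|V|) (X : 'M[R]_#|V|) (t : R) : Prop :=
  let W := sqrtv w *m (sqrtv w)^T in
  [/\ diagv X = const_mx 2^-1 + (t - 2^-1) *: w,
      forall i j, vadj H i j -> Lstar X i j = 1 + (t - 2^-1) * Lstar W i j
    & psdmx X].

Definition sdp_optimal (w : 'cV[R]_#|V|) (X : 'M[R]_#|V|) (t : R) : Prop :=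
  sdp_feasible w X t /\ forall Y s, sdp_feasible w Y s -> t <= s.

End Graph.
End Definitions.

(* Main.v *)
Require Import Defs.
From HB Require Import structures.
From mathcomp Require Import all_boot all_order all_algebra.
From mathcomp Require Import all_classical all_reals.
From mathcomp Require Import topology normedtype derive.
From mathcomp Require Import ring lra.

(** Write mu = 1 - 2 t, s = sqrt w and W = s s^T.  The constraints of the program
say exactly that 2 X = I - mu W + N, where N is symmetric and supported on the
edges of the complement of G [sdp_feasibleP]; so the program maximises mu
subject to I - mu W + N being positive semidefinite.  This is the rescaled
semidefinite dual of theta (compl G) w, and everything follows from two facts.

- mu * (w^T x) <= 1 for x in TH (compl G) [TH_dotv_le].  If mu > 0, take a Gram
  factorization 2 X = B^T B and append sqrt mu * s_i to the i-th column of B.  The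
  Gram matrix of the new vectors is 2 X + mu W = I + N, so they form an
  orthonormal representation of compl G; with c the last basis vector,
  (c^T p(i))^2 = mu * w_i, and the inequality is the one defining TH.

- At an optimal solution mu * theta (compl G) w = 1 [strong_duality].  The
  inequality <= comes from pairing two positive semidefinite matrices
  [weak_duality].  For >=, a conic Farkas lemma [psdmx_farkas] gives for every
  v > theta a feasible solution with mu = 1 / v [sdp_feasible_of_theta_lt], and
  the optimal mu is at least each of these values.

Since w^T x >= 0, the first fact is the inequality 2 t + 1 / (w^T x) >= 1, with
equality iff mu * (w^T x) = 1.  In the case of equality, the same bound applied
to the other feasible solutions shows that (X, t) is optimal, and comparison
with the second fact gives w^T x = theta.  The converse implication is the
second fact itself. *)

Import Order.TTheory GRing.Theory Num.Theory.
Import numFieldNormedType.Exports.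
Local Open Scope classical_set_scope.
Local Open Scope ring_scope.

Set Implicit Arguments.
Unset Strict Implicit.
Unset Printing Implicit Defensive.

(** * Positive semidefinite matrices *)

Section Psd.
Variables (R : realType) (n : nat).
Implicit Types (A B X Y : 'M[R]_n) (u v : 'cV[R]_n) (a : R).

Lemma dotvE m (u v : 'cV[R]_m) : dotv u v = \sum_i u i 0 * v i 0.
Proof. by rewrite /dotv mxE; apply: eq_bigr => i _; rewrite mxE. Qed.

Lemma dotvC m (u v : 'cV[R]_m) : dotv u v = dotv v u.
Proof. by rewrite !dotvE; apply: eq_bigr => i _; rewrite mulrC. Qed.

Lemma dotvDr m (x y z : 'cV[R]_m) : dotv x (y + z) = dotv x y + dotv x z.
Proof. by rewrite /dotv mulmxDr mxE. Qed.

Lemma dotvZr m a (x y : 'cV[R]_m) : dotv x (a *: y) = a * dotv x y.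
Proof. by rewrite /dotv -scalemxAr mxE. Qed.

Lemma dotvZl m a (x y : 'cV[R]_m) : dotv (a *: x) y = a * dotv x y.
Proof. by rewrite dotvC dotvZr dotvC. Qed.

Lemma dotv_delta m i (x : 'cV[R]_m) : dotv (delta_mx i 0) x = x i 0.
Proof. by rewrite /dotv trmx_delta -rowE mxE. Qed.

Lemma dotvv_ge0 m (u : 'cV[R]_m) : 0 <= dotv u u.
Proof. by rewrite dotvE sumr_ge0 // => i _; rewrite -expr2 sqr_ge0. Qed.

Lemma qformE A u : qform A u = dotv u (A *m u).
Proof. by rewrite /qform /dotv mulmxA. Qed.

Lemma qform_mxtrace A u : qform A u = \tr (u *m u^T *m A).
Proof. by rewrite -mulmxA mxtrace_mulC trace_mx11. Qed.

Lemma qformDl A B u : qform (A + B) u = qform A u + qform B u.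
Proof. by rewrite /qform mulmxDr mulmxDl mxE. Qed.

Lemma qformZl a A u : qform (a *: A) u = a * qform A u.
Proof. by rewrite /qform -scalemxAr -scalemxAl mxE. Qed.

Lemma qform_outer v u : qform (v *m v^T) u = dotv v u ^+ 2.
Proof.
rewrite /qform mulmxA -(mulmxA _ v^T) mxE big_ord1 expr2 -/(dotv u v).
by rewrite [in LHS]dotvC.
Qed.

Lemma qform1 u : qform 1%:M u = dotv u u.
Proof. by rewrite qformE mul1mx. Qed.

Lemma qform_delta A i : qform A (delta_mx i 0) = A i i.
Proof. by rewrite /qform trmx_delta -rowE -colE !mxE. Qed.

Lemma qformDr A u v : A^T = A ->
  qform A (u + v) = qform A u + 2 * dotv v (A *m u) + qform A v.
Proof.
move=> sA; rewrite !qformE mulmxDr.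
rewrite dotvDr ![dotv (u + v) _]dotvC !dotvDr ![dotv (A *m _) _]dotvC.
have -> : dotv u (A *m v) = dotv v (A *m u).
  by rewrite dotvC /dotv trmx_mul sA mulmxA.
by ring.
Qed.

Lemma qform_scale A a u : qform A (a *: u) = a ^+ 2 * qform A u.
Proof.
by rewrite /qform [(a *: u)^T]linearZ /= -!scalemxAl -scalemxAr scalerA mxE expr2.
Qed.

Lemma psdmxD A B : psdmx A -> psdmx B -> psdmx (A + B).
Proof.
move=> [sA pA] [sB pB]; split; first by rewrite [LHS]linearD /= sA sB.
by move=> u; rewrite qformDl addr_ge0.
Qed.

Lemma psdmxZ a A : 0 <= a -> psdmx A -> psdmx (a *: A).
Proof.
move=> a0 [sA pA]; split; first by rewrite [LHS]linearZ /= sA.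
by move=> u; rewrite qformZl mulr_ge0.
Qed.

Lemma psdmx_outer v : psdmx (v *m v^T).
Proof.
by split=> [|u]; rewrite ?trmx_mul ?trmxK // qform_outer sqr_ge0.
Qed.

Lemma psdmx1 : psdmx (1%:M : 'M[R]_n).
Proof. by split=> [|u]; rewrite ?trmx1 // qform1 dotvv_ge0. Qed.

Lemma psdmx_diag_ge0 A i : psdmx A -> 0 <= A i i.
Proof. by case=> _ /(_ (delta_mx i 0)); rewrite qform_delta. Qed.

Lemma psdmx_diag_le_trace A i : psdmx A -> A i i <= \tr A.
Proof.
move=> pA; rewrite /mxtrace (bigD1 i) //= lerDl.
by apply: sumr_ge0 => j _; exact: psdmx_diag_ge0.
Qed.

(** Test the form on [e_i + e_j] and [e_i - e_j]. *)
Lemma psdmx_offdiag A i j : psdmx A -> 2 * `|A i j| <= A i i + A j j.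
Proof.
move=> [sA pA].
have E s : qform A (delta_mx i 0 + s *: delta_mx j 0) =
    A i i + 2 * s * A i j + s ^+ 2 * A j j.
  rewrite qformDr // qform_scale !qform_delta dotvZl dotv_delta -colE mxE.
  by rewrite -[in A j i]sA mxE mulrA.
have := pA (delta_mx i 0 + 1 *: delta_mx j 0).
have := pA (delta_mx i 0 + (-1) *: delta_mx j 0).
rewrite !E; case: (ger0P (A i j)) => _; lra.
Qed.

Lemma psdmx_norm_le_trace A i j : psdmx A -> `|A i j| <= \tr A.
Proof.
move=> pA; have := psdmx_offdiag i j pA.
have := psdmx_diag_le_trace i pA; have := psdmx_diag_le_trace j pA; lra.
Qed.

(** Cauchy-Schwarz, from the nonnegative square norm of |v|^2 u - (v.u) v. *)
Lemma sqr_dotv_le v u : dotv v u ^+ 2 <= dotv v v * dotv u u.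
Proof.
have [v0|v0] := eqVneq (dotv v v) 0.
  suff -> : v = 0 by rewrite /dotv trmx0 !mul0mx mxE expr0n mul0r.
  apply/matrixP => i j; rewrite ord1 mxE; move: v0; rewrite dotvE => /eqP.
  rewrite psumr_eq0 => [/allP/(_ i)|k _]; last by rewrite -expr2 sqr_ge0.
  by rewrite mem_index_enum -expr2 sqrf_eq0 => /(_ isT)/eqP.
have vp : 0 < dotv v v by rewrite lt_neqAle eq_sym v0 dotvv_ge0.
have := dotvv_ge0 (dotv v v *: u + (- dotv v u) *: v).
rewrite dotvDr !dotvZr ![dotv (_ + _) _]dotvC !dotvDr !dotvZr [dotv u v]dotvC.
set q := dotv v v in vp *; set c := dotv v u; set s := dotv u u.
have -> : q * (q * s + - c * c) + - c * (q * c + - c * q) = q * (q * s - c ^+ 2).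
  by ring.
by rewrite pmulr_rge0 // subr_ge0.
Qed.

(** One pivot of the Cholesky algorithm: minimising the form of [A] along the
line [u + R e_k] shows that the Schur complement of a nonzero pivot stays
positive semidefinite. *)
Lemma psdmx_pivot A k : psdmx A -> A k k != 0 ->
  psdmx (A - (A k k)^-1 *: (col k A *m (col k A)^T)).
Proof.
move=> pA ak0; have [sA qA] := pA.
split; first by rewrite [LHS]linearB [X in _ - X]linearZ /= trmx_mul trmxK sA.
move=> u; rewrite -scaleNr qformDl qformZl qform_outer.
set d := dotv _ _.
have := qA (u + (- (d / A k k)) *: delta_mx k 0).
rewrite qformDr // qform_scale qform_delta dotvZl dotv_delta.
have -> : (A *m u) k 0 = d.
  by rewrite /d dotvE mxE; apply: eq_bigr => j _; rewrite -[in LHS]sA !mxE.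
suff -> : qform A u + 2 * (- (d / A k k) * d) + (- (d / A k k)) ^+ 2 * A k k =
  qform A u + - (A k k)^-1 * d ^+ 2 by [].
by field.
Qed.

(** Induction on the number of nonzero diagonal entries: each pivot clears one
of them, and a positive semidefinite matrix with zero diagonal vanishes. *)
Lemma psdmx_gram A : psdmx A -> exists d (B : 'M[R]_(d, n)), A = B^T *m B.
Proof.
have [m] := ubnP #|[pred i | A i i != 0]|; elim: m A => // m IH A Am pA.
case: (pickP [pred i | A i i != 0]) => [k /= ak|a0]; last first.
  have a0' i : A i i = 0 by apply/eqP; move: (a0 i) => /= /negbFE.
  exists 0%N, 0; rewrite mulmx0; apply/matrixP => i j; rewrite mxE.
  have := psdmx_offdiag i j pA; rewrite !a0' addr0 pmulr_rle0 ?normr_le0 //.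
  by move/eqP.
have pA' := psdmx_pivot pA ak; have [sA _] := pA.
set A' := A - _ in pA'.
have A'E i : A' i i = A i i - (A k k)^-1 * (A i k) ^+ 2.
  by rewrite !mxE big_ord1 !mxE expr2.
have akp : 0 < A k k by rewrite lt_neqAle eq_sym ak psdmx_diag_ge0.
have lt_m : (#|[pred i | A' i i != 0%R]| < m)%N.
  rewrite -ltnS; apply: leq_trans Am; rewrite ltnS.
  apply: proper_card; apply/fintype.properP; split.
    apply/fintype.subsetP => i; rewrite !inE; apply: contra => /eqP ai.
    apply/eqP/le_anti; rewrite psdmx_diag_ge0 // andbT A'E ai sub0r oppr_le0.
    by rewrite mulr_ge0 ?sqr_ge0 // invr_ge0 ltW.
  exists k; rewrite !inE // A'E negbK expr2 mulrA mulVf // mul1r.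
  by rewrite subrr.
have [d [B AB]] := IH A' lt_m pA'.
exists (d + 1)%N, (col_mx B ((Num.sqrt (A k k)^-1) *: (col k A)^T)).
rewrite tr_col_mx mul_row_col -AB [(_ *: _)^T]linearZ /= trmxK.
by rewrite -scalemxAl -scalemxAr scalerA -expr2 sqr_sqrtr ?invr_ge0 ?ltW // subrK.
Qed.

Lemma mxtrace_gram d (B : 'M[R]_(d, n)) A :
  \tr (B^T *m B *m A) = \sum_k qform A (row k B)^T.
Proof.
rewrite -mulmxA mxtrace_mulC; apply: eq_bigr => k _.
rewrite /qform trmxK -row_mul !mxE; apply: eq_bigr => j _.
by rewrite !mxE.
Qed.

(** Self-duality of the positive semidefinite cone (easy half), through a Gram
factorization of [A]. *)
Lemma psdmx_mxtrace_mul_ge0 A B : psdmx A -> psdmx B -> 0 <= \tr (A *m B).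
Proof.
move=> /psdmx_gram[d [C ->]] [_ qB]; rewrite mxtrace_gram.
by apply: sumr_ge0 => k _; exact: qB.
Qed.

End Psd.

(** * Compactness and a conic Farkas lemma *)

Section Farkas.
Variables (R : realType) (n : nat).
Implicit Types (A B X Y : 'M[R]_n) (u v : 'cV[R]_n) (a : R).

Lemma continuous_bigsum (T : topologicalType) (I : Type) (r : seq I)
    (f : I -> T -> R) :
  (forall i, continuous (f i)) -> continuous (fun x => \sum_(i <- r) f i x).
Proof.
by move=> fc x; apply: cvg_big => [|i _]; [exact: add_continuous|exact: fc].
Qed.

Lemma continuous_mxtraceM A : continuous (fun X => \tr (A *m X)).
Proof.
have -> : (fun X => \tr (A *m X)) = fun X => \sum_i \sum_j A i j * X j i.
  by apply: funext => X; apply: eq_bigr => i _; rewrite mxE.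
apply: continuous_bigsum => i; apply: continuous_bigsum => j X.
apply: (@continuousM _ _ (fun=> A i j)); first exact: cst_continuous.
exact: coord_continuous.
Qed.

Lemma continuous_vec_mx m k : continuous (@vec_mx R m k).
Proof.
move=> v S /= /(nbhs_ballP (vec_mx v)) [e e0 es].
apply/nbhs_ballP; exists e => //= u [_ vu]; apply: es; split=> // i j.
by rewrite !mxE.
Qed.

Lemma closed_eqfun (T : topologicalType) (f g : T -> R) :
  continuous f -> continuous g -> closed [set x | f x = g x].
Proof.
move=> fc gc.
have -> : [set x | f x = g x] = (fun x => f x - g x) @^-1` [set y | y = 0].
  by apply/seteqP; split=> x /= => [->|/subr0_eq//]; rewrite subrr.
apply: (preimage_closed _ (@closed_eq R 0)) => x _.
by apply: (@continuousB _ _ _ f g); [exact: fc|exact: gc].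
Qed.

Lemma closed_psdmx : closed [set X : 'M[R]_n | psdmx X].
Proof.
have -> : [set X : 'M[R]_n | psdmx X] =
    (\bigcap_i [set X : 'M[R]_n | X i.2 i.1 = X i.1 i.2]) `&`
    (\bigcap_(u in [set: 'cV[R]_n]) [set X : 'M[R]_n | 0 <= \tr (u *m u^T *m X)]).
  apply/seteqP; split=> [X [sX qX]|X [sX qX]].
    split=> [[i j] _ /=|u _ /=]; last by rewrite -qform_mxtrace.
    by rewrite -[in LHS]sX mxE.
  split=> [|u]; last by rewrite qform_mxtrace; exact: qX.
  by apply/matrixP => i j; rewrite mxE; exact: (sX (i, j)).
apply: closedI; apply: closed_bigI => i _.
  by apply: closed_eqfun; exact: coord_continuous.
apply: (@preimage_closed _ _ (fun X => \tr (i *m i^T *m X)) [set y | 0 <= y]).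
  by move=> X _; exact: continuous_mxtraceM.
exact: closed_ge.
Qed.

(** A trace bound confines positive semidefinite matrices to a box; compactness
of the box is available for row vectors, to which matrices are transported by
[vec_mx]. *)
Lemma psdmx_argmin (D : set 'M[R]_n) (f : 'M[R]_n -> R) a :
  closed D -> D !=set0 -> continuous f ->
  (forall X, D X -> psdmx X /\ \tr X <= a) ->
  exists2 X, D X & forall Y, D Y -> f X <= f Y.
Proof.
move=> Dcl [X0 DX0] fc Dbd.
pose C := [set v : 'rV[R]_(n * n) | D (vec_mx v)].
have Ccl : closed C.
  by apply: (preimage_closed _ Dcl) => v _; exact: continuous_vec_mx.
have Ccpt : compact C.
  have := @rV_compact R (n * n) (fun=> `[- a, a]%classic)
    (fun=> @segment_compact R _ _).
  move=> box; apply: (subclosed_compact Ccl box) => v Dv k /=.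
  have [pv tv] := Dbd _ Dv; case/mxvec_indexP: k => i j.
  have := le_trans (psdmx_norm_le_trace i j pv) tv.
  by rewrite mxE ler_norml in_itv.
have C0 : C !=set0 by exists (mxvec X0); rewrite /C /= mxvecK.
have [|v] := compact_EVT_min C0 Ccpt (f := f \o vec_mx).
  apply: continuous_subspaceT => v; apply: continuous_comp.
    exact: continuous_vec_mx.
  exact: fc.
rewrite inE => Dv vmin; exists (vec_mx v) => // Y DY.
by have := vmin (mxvec Y); rewrite inE /C /= mxvecK => /(_ DY).
Qed.

Lemma le_add1_of_sqr_le (a b : R) : a ^+ 2 <= b -> a <= b + 1.
Proof. by move=> ab; nra. Qed.

(** If a quadratic function of [s] does not go below its value at 0 on [0, 1],
then its slope at 0 is nonnegative: otherwise the step [min 1 (- b / q)]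
decreases it. *)
Lemma first_order_ge0 (b q : R) : 0 <= q ->
  (forall s : R, 0 < s -> s <= 1 -> 0 <= 2 * s * b + s ^+ 2 * q) -> 0 <= b.
Proof.
move=> q0 H; rewrite leNgt; apply/negP => b0.
have [bq|bq] := lerP q (- b).
  by have := H 1 ltr01 (lexx _); lra.
have q1 : 0 < q by lra.
have s1 : - b / q <= 1 by rewrite ler_pdivrMr // mul1r ltW.
have := H (- b / q) (divr_gt0 _ q1) s1; rewrite oppr_gt0 => /(_ b0).
have -> : 2 * (- b / q) * b + (- b / q) ^+ 2 * q = - (b ^+ 2 / q).
  by field; lra.
by rewrite oppr_ge0 leNgt divr_gt0 // exprn_even_gt0 //= lt_eqF.
Qed.

(** Let [Y] minimise the sum of the squared residuals [tr (A_k Y) - z_k] over the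
cone.  If they do not all vanish, the residual vector separates [z] from the
image of the cone.  The identity among the [A_k] makes the trace part of the
residual, so the minimum may be sought among matrices of bounded trace, where it
is attained; without it the image of the cone need not be closed, and the
alternative can fail. *)
Lemma psdmx_farkas (K : finType) (A : K -> 'M[R]_n) (z : K -> R) k0 :
  A k0 = 1%:M ->
  (exists2 Y, psdmx Y & forall k, \tr (A k *m Y) = z k) \/
  (exists2 r : K -> R,
    forall Y, psdmx Y -> 0 <= \tr ((\sum_k r k *: A k) *m Y) &
    \sum_k r k * z k < 0).
Proof.
move=> A0.
pose res Y k := \tr (A k *m Y) - z k.
pose Q Y := \sum_k res Y k ^+ 2.
have Qc : continuous Q.
  apply: continuous_bigsum => k Y; apply: (@continuousM _ _ (res^~ k) (res^~ k));
  apply: (@continuousB _ _ _ (fun X => \tr (A k *m X)) (fun=> z k));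
  by [exact: continuous_mxtraceM|exact: cst_continuous].
have psd0 : psdmx (0 : 'M[R]_n).
  by rewrite -(scale0r 1%:M); apply: psdmxZ => //; exact: psdmx1.
pose c := `|z k0| + Q 0 + 1.
have Q_ge0 Y : 0 <= Q Y by apply: sumr_ge0 => k _; exact: sqr_ge0.
pose D := [set Y : 'M[R]_n | psdmx Y] `&` [set Y | \tr (1%:M *m Y) <= c].
have D0 : D 0 by split=> //=; rewrite mulmx0 linear0 /c !addr_ge0.
have Dcl : closed D.
  apply: closedI; first exact: closed_psdmx.
  apply: (@preimage_closed _ _ (fun X => \tr (1%:M *m X)) [set y | y <= c]).
    by move=> X _; exact: continuous_mxtraceM.
  exact: closed_le.
have Dbd X : D X -> psdmx X /\ \tr X <= c by case=> pX; rewrite /= mul1mx.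
have [Y [pY _] Ymin0] := psdmx_argmin Dcl (ex_intro _ 0 D0) Qc Dbd.
(* A trace above [c] already makes the residual at [k0] worse than [Q 0]. *)
have Ymin Z : psdmx Z -> Q Y <= Q Z.
  move=> pZ; have [tZ|tZ] := lerP (\tr Z) c.
    by apply: Ymin0; split=> //=; rewrite mul1mx.
  apply: le_trans (Ymin0 _ D0) _; rewrite leNgt; apply/negP => ZQ.
  have le_res : res Z k0 ^+ 2 <= Q 0.
    apply: ltW; apply: le_lt_trans ZQ; rewrite /Q (bigD1 k0) //= lerDl.
    by apply: sumr_ge0 => k _; exact: sqr_ge0.
  have := le_add1_of_sqr_le le_res; rewrite /res A0 mul1mx => tZ'.
  by have := ler_norm (z k0); move: tZ; rewrite /c; lra.
have trS (r : K -> R) Z : \tr ((\sum_k r k *: A k) *m Z) =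
    \sum_k r k * \tr (A k *m Z).
  rewrite mulmx_suml linear_sum; apply: eq_bigr => k _.
  by rewrite /= -scalemxAl mxtraceZ.
pose g Z := \sum_k res Y k * \tr (A k *m Z).
have Qexp s Z : Q (Y + s *: Z) =
    Q Y + 2 * s * g Z + s ^+ 2 * \sum_k \tr (A k *m Z) ^+ 2.
  rewrite /Q /g !mulr_sumr -!big_split; apply: eq_bigr => k _ /=.
  by rewrite /res mulmxDr -scalemxAr mxtraceD mxtraceZ; ring.
have q_ge0 Z : 0 <= \sum_k \tr (A k *m Z) ^+ 2.
  by apply: sumr_ge0 => k _; exact: sqr_ge0.
(* First-order conditions: [Y] may be moved in every direction of the cone, and
   also towards 0, hence [g Y = 0]. *)
have g_ge0 Z : psdmx Z -> 0 <= g Z.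
  move=> pZ; apply: (first_order_ge0 (q_ge0 Z)) => s s0 _.
  have /Ymin : psdmx (Y + s *: Z).
    by apply: psdmxD => //; apply: psdmxZ => //; exact: ltW.
  by rewrite Qexp -addrA lerDl.
have gY : g Y <= 0.
  rewrite -oppr_ge0; apply: (first_order_ge0 (q_ge0 Y)) => s s0 s1.
  have /Ymin : psdmx (Y + (- s) *: Y).
    rewrite -{1}[Y]scale1r -scalerDl; apply: psdmxZ => //; lra.
  by rewrite Qexp -addrA lerDl; lra.
have [QY0|QY0] := eqVneq (Q Y) 0.
  left; exists Y => // k; apply/eqP; rewrite -subr_eq0 -sqrf_eq0.
  move/eqP: QY0; rewrite psumr_eq0 => [/allP/(_ k)|? _]; last exact: sqr_ge0.
  by rewrite mem_index_enum => /(_ isT).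
right; exists (res Y) => [Z pZ|]; first by rewrite trS; exact: g_ge0.
have -> : \sum_k res Y k * z k = g Y - Q Y.
  rewrite /g /Q -sumrB; apply: eq_bigr => k _; rewrite /res; ring.
have : 0 < Q Y by rewrite lt_neqAle eq_sym QY0 Q_ge0.
lra.
Qed.

End Farkas.

(** * The program, the theta function and TH *)

Section Duality.
Variables (R : realType) (V : finType) (V_gt0 : (0 < #|V|)%N) (G : sgraph V).
Variable w : 'cV[R]_#|V|.
Hypothesis w_ge0 : forall i, 0 <= w i 0.
Implicit Types (X Y : 'M[R]_#|V|) (x : 'cV[R]_#|V|) (t v : R).

Local Notation s := (sqrtv w).
Local Notation W := (s *m s^T).

Lemma sqr_sqrtv i : s i 0 * s i 0 = w i 0.
Proof. by rewrite mxE -expr2 sqr_sqrtr. Qed.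

Lemma outer_sqrtvE i j : W i j = s i 0 * s j 0.
Proof. by rewrite mxE big_ord1 [_^T _ _]mxE. Qed.

Lemma scalar_outerE (a b : R) i j :
  (a *: 1%:M + b *: W) i j = a * (i == j)%:R + b * (s i 0 * s j 0).
Proof.
by rewrite -outer_sqrtvE [LHS]mxE; congr (_ + _); rewrite mxE // mxE.
Qed.

Lemma dotv_sqrtv : dotv s s = \sum_i w i 0.
Proof. by rewrite dotvE; apply: eq_bigr => i _; exact: sqr_sqrtv. Qed.

Lemma vadj_compl i j : vadj (compl G) i j = (i != j) && ~~ vadj G i j.
Proof. by rewrite /vadj /= /compl_adj /= (inj_eq enum_val_inj). Qed.

(** With the diagonal known, the edge constraints of [Lstar] fix the entries of
[X] on the edges of [G]; the remaining off-diagonal entries are free. *)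
Lemma sdp_feasibleP X t : sdp_feasible G w X t <->
  [/\ forall i, X i i = 2^-1 + (t - 2^-1) * w i 0,
      forall i j, vadj G i j -> X i j = (t - 2^-1) * (s i 0 * s j 0)
    & psdmx X].
Proof.
split=> [[dX LX pX]|[dX eX pX]].
  have dXi i : X i i = 2^-1 + (t - 2^-1) * w i 0.
    by have /matrixP/(_ i 0) := dX; rewrite !mxE.
  split=> // i j /LX; rewrite /Lstar !dXi !outer_sqrtvE !sqr_sqrtv; lra.
split=> // [|i j Gij]; first by apply/matrixP => i j; rewrite ord1 !mxE dX.
rewrite /Lstar !dX !outer_sqrtvE !sqr_sqrtv eX //; lra.
Qed.

(** [X] differs from [I / 2 + (t - 1 / 2) W] only on the edges of the complement
of [G], where [Y] vanishes. *)
Lemma sdp_feasible_mxtrace X t Y :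
  sdp_feasible G w X t -> theta_feasible (compl G) Y ->
  \tr (X *m Y) = 2^-1 + (t - 2^-1) * qform Y s.
Proof.
move=> /sdp_feasibleP[dX eX _] [trY Y0 _].
transitivity (\tr ((2^-1 *: 1%:M + (t - 2^-1) *: W) *m Y)); last first.
  rewrite mulmxDl -!scalemxAl mxtraceD !mxtraceZ mul1mx trY mulr1.
  by rewrite qform_mxtrace.
apply: eq_bigr => i _; rewrite [LHS]mxE [RHS]mxE; apply: eq_bigr => j _.
rewrite scalar_outerE; have [->|ij] := eqVneq i j.
  by rewrite dX sqr_sqrtv mulr1.
have [Gij|nGij] := boolP (vadj G i j); first by rewrite eX // mulr0 add0r.
by rewrite Y0 ?mulr0 // vadj_compl eq_sym ij /vadj adj_sym.
Qed.

Lemma weak_duality X t Y :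
  sdp_feasible G w X t -> theta_feasible (compl G) Y ->
  (1 - 2 * t) * qform Y s <= 1.
Proof.
move=> fX fY; have [_ _ pX] := fX; have [_ _ pY] := fY.
have := psdmx_mxtrace_mul_ge0 pX pY; rewrite (sdp_feasible_mxtrace fX fY); lra.
Qed.

(** The supremum is that of a bounded set: by Cauchy-Schwarz, |s|^2 I - s s^T is
positive semidefinite, and pairing it with a feasible matrix bounds the
objective by |s|^2. *)
Lemma theta_ub Y : theta_feasible (compl G) Y ->
  qform Y s <= theta (compl G) w.
Proof.
move=> fY; apply: ub_le_sup; last by exists Y.
exists (dotv s s) => _ [Z [trZ _ pZ] <-].
have pC : psdmx (dotv s s *: 1%:M - W).
  split=> [|u].
    by rewrite [LHS]linearB [X in X - _]linearZ /= trmx1 trmx_mul trmxK.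
  rewrite -scaleN1r qformDl !qformZl qform1 qform_outer mulN1r subr_ge0.
  exact: sqr_dotv_le.
have := psdmx_mxtrace_mul_ge0 pC pZ.
rewrite mulmxBl linearB /= -scalemxAl mxtraceZ mul1mx trZ mulr1.
by rewrite qform_mxtrace subr_ge0.
Qed.

(** The objective takes the mean weight as value at this matrix, whence the lower
bound [sum_le_theta]. *)
Lemma theta_feasible1 : theta_feasible (compl G) (#|V|%:R^-1 *: 1%:M : 'M[R]_#|V|).
Proof.
split; last by apply: psdmxZ; [rewrite invr_ge0 ler0n|exact: psdmx1].
  by rewrite mxtraceZ mxtrace1 mulVf // pnatr_eq0 -lt0n.
by move=> i j; rewrite vadj_compl => /andP[/negbTE ij _]; rewrite !mxE ij mulr0.
Qed.

Lemma sum_le_theta : \sum_i w i 0 <= #|V|%:R * theta (compl G) w.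
Proof.
have := theta_ub theta_feasible1.
by rewrite qformZl qform1 dotv_sqrtv ler_pdivrMl // ltr0n.
Qed.

Lemma theta_ge0 : 0 <= theta (compl G) w.
Proof.
have : 0 <= #|V|%:R * theta (compl G) w.
  by apply: le_trans sum_le_theta; exact: sumr_ge0.
by rewrite pmulr_rge0 // ltr0n.
Qed.

(** The Gram vectors of [2 X], each lengthened by one coordinate
[sqrt (1 - 2 t) * sqrt w_i], form an orthonormal representation of [compl G];
the last basis vector [c] reads off the added coordinate. *)
Lemma TH_dotv_le X t x : sdp_feasible G w X t -> TH (compl G) x ->
  (1 - 2 * t) * dotv w x <= 1.
Proof.
move=> /sdp_feasibleP[dX eX pX] [x0 THx].
have wx0 : 0 <= dotv w x by rewrite dotvE sumr_ge0 // => i _; rewrite mulr_ge0.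
have [m0|m0] := lerP (1 - 2 * t) 0.
  by apply: le_trans ler01; rewrite mulr_le0_ge0.
have p2X : psdmx (2 *: X) by apply: psdmxZ.
have [d [B XB]] := psdmx_gram p2X.
set m := 1 - 2 * t in m0 *.
pose P := col_mx B (Num.sqrt m *: s^T).
pose p (a : V) := col (enum_rank a) P.
pose c : 'cV[R]_(d + 1) := col_mx 0 1%:M.
have pp a b : dotv (p a) (p b) = 2 * X (enum_rank a) (enum_rank b)
    + m * (s (enum_rank a) 0 * s (enum_rank b) 0).
  transitivity ((P^T *m P) (enum_rank a) (enum_rank b)).
    by rewrite dotvE !mxE; apply: eq_bigr => k _; rewrite !mxE.
  rewrite tr_col_mx mul_row_col -XB [(_ *: _)^T]linearZ /= trmxK.
  rewrite -scalemxAl -scalemxAr scalerA -expr2 sqr_sqrtr ?ltW //.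
  by rewrite -outer_sqrtvE !mxE.
have cp a : dotv c (p a) = Num.sqrt m * s (enum_rank a) 0.
  rewrite dotvE big_split_ord /= big_ord1 big1 => [|k _].
    rewrite add0r /c col_mxEd mxE mul1r /p mxE /P col_mxEd [LHS]mxE.
    by congr (_ * _); rewrite mxE.
  by rewrite /c col_mxEu mxE mul0r.
have d0 : (0 < d + 1)%N by rewrite addn1.
have := THx _ p c d0.
have -> : \sum_i dotv c (p (enum_val i)) ^+ 2 * x i 0 = m * dotv w x.
  rewrite dotvE mulr_sumr; apply: eq_bigr => i _.
  rewrite cp enum_valK exprMn sqr_sqrtr ?ltW // -sqr_sqrtv expr2.
  by rewrite !mulrA.
apply.
  split=> [a|a b ab nGab].
    by rewrite pp dX -sqr_sqrtv /m; lra.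
  rewrite pp eX; first by rewrite /m; lra.
  rewrite /vadj !enum_rankK; move: nGab; rewrite /= /compl_adj /= ab /=.
  by rewrite negbK.
rewrite dotvE big_split_ord /= big_ord1 big1 => [|k _].
  by rewrite add0r /c col_mxEd mxE mul1r.
by rewrite /c col_mxEu mxE mul0r.
Qed.

(** No matrix of the cone has trace 1, vanishes on the edges of [compl G] and has
objective value [v].  The Farkas lemma therefore gives [al], [be] and [N],
supported on those edges, with [al I + be W + N] positive semidefinite and
[al + be v < 0].  Once [be < 0] is known, division by [- be v] gives a feasible
solution with [1 - 2 t = 1 / v]. *)
Lemma sdp_feasible_of_theta_lt v : theta (compl G) w < v ->
  exists X, sdp_feasible G w X (2^-1 - (2 * v)^-1).
Proof.
move=> tv; have v0 : 0 < v by apply: le_lt_trans tv; exact: theta_ge0.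
pose K := (bool + 'I_#|V| * 'I_#|V|)%type.
(* Symmetrised matrix units, since only symmetric combinations can be positive
   semidefinite; pairs that are no edges contribute a vacuous constraint. *)
pose E (ij : 'I_#|V| * 'I_#|V|) : 'M[R]_#|V| :=
  (vadj (compl G) ij.1 ij.2)%:R *: (delta_mx ij.1 ij.2 + delta_mx ij.2 ij.1).
pose A (k : K) := match k with
  | inl true => 1%:M | inl false => W | inr ij => E ij end.
pose z (k : K) := match k with inl true => 1 | inl false => v | inr _ => 0 end.
have [[Y pY Yz]|[r rA rz]] := psdmx_farkas z (erefl : A (inl true) = 1%:M).
  suff fY : theta_feasible (compl G) Y.
    by have := theta_ub fY; rewrite qform_mxtrace (Yz (inl false)) leNgt tv.
  split=> // [|i j ij]; first by have := Yz (inl true); rewrite /= mul1mx.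
  have trD (a b : 'I_#|V|) : \tr (delta_mx a b *m Y) = Y b a.
    rewrite -(mul_delta_mx (0 : 'I_1)) -mulmxA mxtrace_mulC trace_mx11.
    by rewrite -mulmxA -colE -rowE !mxE.
  have : \tr (E (i, j) *m Y) = 0 := Yz (inr (i, j)).
  rewrite /E ij scale1r mulmxDl mxtraceD !trD.
  by case: pY => sY _; rewrite -[in Y j i]sY mxE; lra.
pose al := r (inl true); pose be := r (inl false).
pose N := \sum_ij r (inr ij) *: E ij.
have rAE : \sum_k r k *: A k = al *: 1%:M + be *: W + N.
  by rewrite big_sumType big_bool.
have {rz} ab : al + be * v < 0.
  move: rz; rewrite big_sumType big_bool /= mulr1 [X in _ + _ + X]big1 ?addr0 //.
  by move=> ij _; rewrite mulr0.
have NE i j : ~~ vadj (compl G) i j -> N i j = 0.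
  move=> nij; rewrite /N summxE big1 // => -[a b] _; rewrite /E !mxE.
  case: (boolP (vadj _ _ _)) => [ab'|_]; last by rewrite mul0r mulr0.
  rewrite [(a, b).1]/= [(a, b).2]/= in ab' *.
  have nji : ~~ vadj (compl G) j i by rewrite /vadj adj_sym.
  have [/andP[/eqP ia /eqP jb]|_] := boolP ((i == a) && (j == b)).
    by move: nij; rewrite ia jb ab'.
  have [/andP[/eqP ib /eqP ja]|_] := boolP ((i == b) && (j == a)).
    by move: nji; rewrite ib ja ab'.
  by rewrite /= addr0 !mulr0.
have nii i : ~~ vadj (compl G) i i by rewrite vadj_compl eqxx.
have sN : N^T = N.
  apply/matrixP => i j; rewrite mxE /N !summxE; apply: eq_bigr => ij _.
  by rewrite /E !mxE addrC ![(j == _) && _]andbC.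
have qA u : 0 <= al * dotv u u + be * dotv s u ^+ 2 + qform N u.
  have := rA _ (psdmx_outer u).
  by rewrite rAE mxtrace_mulC -qform_mxtrace !qformDl !qformZl qform1 qform_outer.
(* Pairing with the identity gives [al n + be (sum w) >= 0]; as
   [sum w <= n theta <= n v], [be >= 0] would contradict [al + be v < 0]. *)
have be0 : be < 0.
  rewrite ltNge; apply/negP => be0.
  have := rA _ (psdmx1 _ _); rewrite mulmx1 rAE !mxtraceD !mxtraceZ mxtrace1.
  have -> : \tr W = \sum_i w i 0.
    by apply: eq_bigr => i _; rewrite outer_sqrtvE sqr_sqrtv.
  have -> : \tr N = 0 by apply: big1 => i _; exact: NE.
  rewrite addr0 leNgt => /negP; apply.
  have n0 : 0 < #|V|%:R :> R by rewrite ltr0n.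
  have : be * (\sum_i w i 0) <= be * (#|V|%:R * v).
    apply: ler_wpM2l => //; apply: le_trans sum_le_theta _.
    by rewrite ler_pM2l // ltW.
  have : #|V|%:R * (al + be * v) < 0 by rewrite pmulr_rlt0.
  lra.
pose X := 2^-1 *: (1%:M + v^-1 *: (- W) + (- be * v)^-1 *: N).
exists X.
have XE i j : X i j =
    2^-1 * ((i == j)%:R - v^-1 * (s i 0 * s j 0) + (- be * v)^-1 * N i j).
  by rewrite /X -outer_sqrtvE; move: (W) (N) => W' N'; rewrite !mxE mulrN.
have bv0 : 0 < - be * v by rewrite mulr_gt0 // oppr_gt0.
have tE : 2^-1 - (2 * v)^-1 - 2^-1 = - (2^-1 * v^-1) by rewrite invfM; lra.
apply/sdp_feasibleP; rewrite tE; split=> [i|i j Gij|].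
- by rewrite XE eqxx NE // sqr_sqrtv /=; ring.
- have ij : i != j by apply: contraTneq Gij => ->; rewrite /vadj adj_irr.
  by rewrite XE (negbTE ij) NE ?vadj_compl ?Gij ?andbF // /=; ring.
split=> [|u].
  apply/matrixP => i j; rewrite mxE !XE eq_sym [s j 0 * _]mulrC.
  by rewrite -[in N j i]sN [N^T j i]mxE.
rewrite /X -scaleN1r !(qformZl, qformDl) qform1 qform_outer.
have -> : 2^-1 * (dotv u u + v^-1 * (-1 * dotv s u ^+ 2) +
      (- be * v)^-1 * qform N u) =
    2^-1 * (- be * v)^-1 *
      (- be * v * dotv u u + be * dotv s u ^+ 2 + qform N u).
  by field; rewrite ?(lt_eqF be0) ?(gt_eqF v0).
apply: mulr_ge0; first by rewrite mulr_ge0 // invr_ge0 ltW.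
(* Replacing [al] by the larger [- be v] keeps the form nonnegative. *)
apply: le_trans (qA u) _.
by rewrite !lerD2r; apply: ler_wpM2r; [exact: dotvv_ge0|lra].
Qed.

Lemma theta_gt0 : w != 0 -> 0 < theta (compl G) w.
Proof.
move=> w0; have : 0 < \sum_i w i 0.
  rewrite lt_neqAle sumr_ge0 // andbT eq_sym psumr_eq0 //.
  apply: contra w0 => /allP w0; apply/eqP/matrixP => i j.
  by rewrite ord1 mxE; apply/eqP; apply: w0; rewrite mem_index_enum.
by move=> /lt_le_trans/(_ sum_le_theta); rewrite pmulr_rgt0 // ltr0n.
Qed.

Lemma theta_mul_le1 X t : sdp_feasible G w X t ->
  (1 - 2 * t) * theta (compl G) w <= 1.
Proof.
move=> fX; have [m0|m0] := lerP (1 - 2 * t) 0.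
  by apply: le_trans ler01; rewrite mulr_le0_ge0 // theta_ge0.
rewrite mulrC -ler_pdivlMr // mul1r; apply: ge_sup.
  by eexists; exists (#|V|%:R^-1 *: 1%:M); [exact: theta_feasible1|reflexivity].
move=> _ [Y fY <-].
by rewrite -[leRHS]mul1r ler_pdivlMr // mulrC (weak_duality fX fY).
Qed.

(** Optimality gives [1 <= (1 - 2 t) v] for every [v > theta]; let [v] tend to
[theta]. *)
Lemma strong_duality X t : w != 0 -> sdp_optimal G w X t ->
  (1 - 2 * t) * theta (compl G) w = 1.
Proof.
move=> w0 [fX Xopt]; apply/eqP; rewrite eq_le (theta_mul_le1 fX) /=.
have th0 := theta_gt0 w0.
have lt_bound v : theta (compl G) w < v -> 1 <= (1 - 2 * t) * v.
  move=> tv; have v0 : 0 < v := lt_trans th0 tv.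
  have [Y /Xopt] := sdp_feasible_of_theta_lt tv.
  by rewrite -ler_pdivrMr // invfM; lra.
have m0 : 0 < 1 - 2 * t.
  have := lt_bound _ (ltr_pwDr ltr01 (lexx (theta (compl G) w))).
  move=> /(lt_le_trans ltr01); rewrite pmulr_lgt0 //; lra.
rewrite -ler_pdivrMl // mulr1; apply/ler_addgt0Pr => e e0.
by rewrite -[leLHS]mulr1 ler_pdivrMl // lt_bound // ltrDl.
Qed.

End Duality.

Theorem theorem3p12 (R : realType) (V : finType) (V_gt0 : (0 < #|V|)%N)
    (G : sgraph V) (w : 'cV[R]_#|V|) (w_neq0 : w != 0)
    (w_ge0 : forall i, 0 <= w i 0)
    (X : 'M[R]_#|V|) (t : R) (Xt_feasible : sdp_feasible G w X t)
    (x : 'cV[R]_#|V|) (x_neq0 : x != 0) (x_TH : TH (compl G) x) :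
  (1 <= (2 * t)%:E + (dotv w x)%:E^-1)%E /\
  (((2 * t)%:E + (dotv w x)%:E^-1)%E = 1%E <->
   sdp_optimal G w X t /\ dotv w x = theta (compl G) w).
Proof.
have th0 := theta_gt0 V_gt0 G w_ge0 w_neq0.
have bound Y s (fY : sdp_feasible G w Y s) := TH_dotv_le w_ge0 fY x_TH.
have [wx0|wx0] := eqVneq (dotv w x) 0.
  rewrite wx0 inve0 addey // leey; split=> //; split=> // -[_ th].
  by move: th0; rewrite -th ltxx.
have wx_gt0 : 0 < dotv w x.
  rewrite lt_neqAle eq_sym wx0 dotvE sumr_ge0 // => i _.
  by rewrite mulr_ge0 //; case: x_TH.
have inv_eq : (2 * t + (dotv w x)^-1 = 1) <-> (1 - 2 * t) * dotv w x = 1.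
  split=> [e|e].
    suff -> : 1 - 2 * t = (dotv w x)^-1 by rewrite mulVf.
    by apply/eqP; rewrite subr_eq addrC e.
  have -> : (dotv w x)^-1 = 1 - 2 * t by rewrite -[LHS]mul1r -[X in X / _]e mulfK.
  by ring.
rewrite inver (negbTE wx0) -EFinD; split.
  by rewrite lee_fin -lerBlDl -[leRHS]mul1r ler_pdivlMr // (bound _ _ Xt_feasible).
split=> [[eq1]|[opt e]].
  have e := proj1 inv_eq eq1.
  have opt : sdp_optimal G w X t.
    split=> // Y s fY; have := bound _ _ fY; rewrite -[leRHS]e ler_pM2r //; lra.
  split=> //; have := strong_duality V_gt0 w_ge0 w_neq0 opt; rewrite -[RHS]e.
  have m0 : 1 - 2 * t != 0.
    apply/eqP => m0; move: e; rewrite m0 mul0r.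
    by apply/eqP; rewrite eq_sym oner_eq0.
  by move=> /(mulfI m0) ->.
congr (_%:E); apply: (proj2 inv_eq).
by rewrite e (strong_duality V_gt0 w_ge0 w_neq0 opt).
Qed.
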